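(* For a positive integer $n$ let $$\mathrm{H}(n)=\sum_{i=0}^{F_n-1}\frac{\sqrt{F_{n+1}+i}}{2}.$$ Then $$\lim_{n\to\infty}\frac{\mathrm{H}(n)}{\mathrm{H}(n-1)}=\varphi\sqrt{\varphi}.$$
   Context: $F_n$ denotes the $n$-th Fibonacci number: $F_1=F_2=1$ and $F_{n+1}=F_n+F_{n-1}$ for $n\ge 2$. $\varphi=(1+\sqrt5)/2$. $\mathrm{H}(n)$ is called the $n$-th Hahn area: it is the total area of $F_n$ consecutive triangles of the (classical) spiral of Theodorus, starting with the $F_{n+1}$-th triangle, where the $k$-th triangle of that spiral is the right triangle with legs $\sqrt{k}$ and $1$. *)

(* Defs.v *)
From mathcomp Require Import all_boot all_order all_algebra.
From mathcomp Require Import all_classical all_reals all_analysis.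

Set Implicit Arguments.
Unset Strict Implicit.
Unset Printing Implicit Defensive.

Import Order.TTheory GRing.Theory Num.Theory.
Import numFieldNormedType.Exports.

Local Open Scope ring_scope.

(* Indexed so that fib 1 = fib 2 = 1; fib 0 = 0 extends the recurrence. *)
Fixpoint fib (n : nat) : nat :=
  match n with
  | 0 => 0
  | 1 => 1
  | (m.+1 as p).+1 => (fib p + fib m)%N
  end.

Definition golden_ratio (R : realType) : R := (1 + Num.sqrt 5) / 2.

(* Num.sqrt k%:R / 2 is the area of the k-th triangle of the spiral of
   Theodorus, with legs sqrt k and 1.  At the index n = 0, which is not used
   in the mathematics, the sum is empty and the value is 0. *)
Definition hahn_area (R : realType) (n : nat) : R :=
  \sum_(0 <= i < fib n) Num.sqrt (fib n.+1 + i)%:R / 2.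

(* Main.v *)
Require Import Defs.
From mathcomp Require Import all_boot all_order all_algebra.
From mathcomp Require Import all_classical all_reals all_analysis.
From mathcomp Require Import ring lra zify.

(** With [a = fib n.+1] and [b = fib n.+2], the sum of [sqrt k] over
    [a <= k < b] differs from [2/3 (b sqrt b - a sqrt a)] by at most
    [sqrt b - sqrt a].  As [b / a] tends to the golden ratio [phi], dividing by
    [a sqrt a] gives a positive limit [2/3 (phi sqrt phi - 1)], which cancels in
    the quotient of two consecutive areas and leaves
    [lim (a_n sqrt a_n) / (a_(n-1) sqrt a_(n-1)) = phi sqrt phi]. *)

Import Order.TTheory GRing.Theory Num.Theory.
Import numFieldNormedType.Exports.

Local Open Scope classical_set_scope.
Local Open Scope ring_scope.

Lemma golden_ratio_sqr (R : realType) :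
  golden_ratio R * golden_ratio R = golden_ratio R + 1.
Proof.
have h5 : Num.sqrt 5 * Num.sqrt 5 = 5 :> R by rewrite -expr2 sqr_sqrtr.
by rewrite /golden_ratio; lra.
Qed.

Lemma golden_ratio_bounds (R : realType) : 1 < golden_ratio R < 2.
Proof.
have h5 : Num.sqrt 5 * Num.sqrt 5 = 5 :> R by rewrite -expr2 sqr_sqrtr.
have h0 : 0 <= Num.sqrt 5 :> R by exact: sqrtr_ge0.
by rewrite /golden_ratio; apply/andP; split; nra.
Qed.

(** [1 - golden_ratio R] is the conjugate root of [x^2 = x + 1]. The product of the two roots is -1,
    so each step of the recurrence multiplies the left-hand side by this root. *)
Lemma fib_golden_ratio (R : realType) n :
  (fib n.+1)%:R - golden_ratio R * (fib n)%:R = (1 - golden_ratio R) ^+ n.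
Proof.
elim: n => [|n IH]; first by rewrite /= mulr0 subr0.
have -> : fib n.+2 = (fib n.+1 + fib n)%N by [].
rewrite exprS -IH natrD.
by have := golden_ratio_sqr R; move: (golden_ratio R) => p hp; ring: hp.
Qed.

Lemma fib_gt0 n : (0 < fib n.+1)%N.
Proof. by elim: n => // n IH; rewrite (_ : fib n.+2 = fib n.+1 + fib n)%N ?addn_gt0 ?IH. Qed.

Lemma leq_fib n : (n <= fib n.+1)%N.
Proof.
case: n => // n; elim: n => // n IH.
have -> : fib n.+3 = (fib n.+2 + fib n.+1)%N by [].
by have := fib_gt0 n; lia.
Qed.

Lemma cvg_fib_inv (R : realType) : ((fib n.+1)%:R : R)^-1 @[n --> \oo] --> (0 : R).
Proof.
(* The shift matches [harmonic], whose term at [n] is [1 / (n + 1)], with the bound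
   [n.+1 <= fib n.+2]. *)
rewrite -(cvg_shiftS (fun n => ((fib n.+1)%:R : R)^-1)).
apply: (squeeze_cvgr _ (cvg_cst 0) (@cvg_harmonic R)).
apply: nearW => n; rewrite invr_ge0 ler0n andTb /harmonic.
by rewrite lef_pV2 ?posrE ?ltr0n ?fib_gt0 // ler_nat; exact: (leq_fib n.+1).
Qed.

(** The error is a power of [1 - golden_ratio R], of absolute value at most 1, divided by
    [fib n.+1]; hence it is at most [1 / fib n.+1]. *)
Lemma cvg_fib_ratio (R : realType) :
  (fib n.+2)%:R / (fib n.+1)%:R @[n --> \oo] --> golden_ratio R.
Proof.
apply/cvgrPdistC_lt => e e0.
near=> n.
have F0 : 0 < (fib n.+1)%:R :> R by rewrite ltr0n fib_gt0.
have -> : (fib n.+2)%:R / (fib n.+1)%:R - golden_ratio R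
    = (1 - golden_ratio R) ^+ n.+1 / (fib n.+1)%:R.
  by rewrite -fib_golden_ratio mulrBl mulfK ?gt_eqF.
have : (fib n.+1)%:R^-1 < e.
  by near: n; apply: (cvgr_lt (0 : R)) => //; exact: cvg_fib_inv.
apply: le_lt_trans.
rewrite normrM normrX normfV (gtr0_norm F0).
rewrite ler_piMl ?invr_ge0 ?(ltW F0) // exprn_ile1 //.
by have := golden_ratio_bounds R; rewrite ler_norml; lra.
Unshelve. all: by end_near. Qed.

Lemma cvg_sqrt_fib_ratio (R : realType) :
  Num.sqrt ((fib n.+2)%:R / (fib n.+1)%:R) @[n --> \oo]
    --> Num.sqrt (golden_ratio R).
Proof.
apply: (@cvg_comp _ _ _ _ (@Num.sqrt R) _ _ _ (@cvg_fib_ratio R)).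
exact: sqrt_continuous.
Qed.

Lemma cvg_sqrt_fib_ratio_cube (R : realType) :
  Num.sqrt ((fib n.+2)%:R / (fib n.+1)%:R) ^+ 3 @[n --> \oo]
    --> Num.sqrt (golden_ratio R) ^+ 3.
Proof.
apply: (@cvg_comp _ _ _ _ (fun x : R => x ^+ 3) _ _ _ (@cvg_sqrt_fib_ratio R)).
exact: exprn_continuous.
Qed.

Section sum_sqrt.
Variable R : rcfType.

(** The middle term is the integral of the square root from [s^2] to [t^2], compared with the
    rectangles of heights [s] and [t]. Both differences are [(t - s)^2] times a nonnegative
    factor. *)
Lemma cube_increment_bounds (s t : R) : 0 <= s -> s <= t ->
  s * (t ^+ 2 - s ^+ 2) <= 2 / 3 * (t ^+ 3 - s ^+ 3) <= t * (t ^+ 2 - s ^+ 2).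
Proof.
move=> s0 st; rewrite -subr_ge0 -[X in _ && X]subr_ge0.
have -> : 2 / 3 * (t ^+ 3 - s ^+ 3) - s * (t ^+ 2 - s ^+ 2)
  = (t - s) ^+ 2 * (2 * t + s) / 3 by field.
have -> : t * (t ^+ 2 - s ^+ 2) - 2 / 3 * (t ^+ 3 - s ^+ 3)
  = (t - s) ^+ 2 * (2 * s + t) / 3 by field.
by rewrite !mulr_ge0 ?invr_ge0 ?sqr_ge0 //; lra.
Qed.

(** On unit intervals the left and right Riemann sums differ by a telescoping sum, which is the
    error term [sqrt b - sqrt a]. *)
Lemma sum_sqrt_bounds (a m : nat) :
  let S := \sum_(0 <= i < m) Num.sqrt (a + i)%:R : R in
  let b := (a + m)%N in
  S <= 2 / 3 * (Num.sqrt b%:R ^+ 3 - Num.sqrt a%:R ^+ 3)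
    <= S + (Num.sqrt b%:R - Num.sqrt a%:R).
Proof.
elim: m => [|m IH] /=; first by rewrite big_geq // addn0 !subrr mulr0 addr0 lexx.
rewrite big_nat_recr //=; move: IH => /=.
move: (\sum_(0 <= i < m) _) => S.
have st : Num.sqrt (a + m)%:R <= Num.sqrt (a + m.+1)%:R :> R.
  by rewrite ler_wsqrtr // ler_nat addnS.
have := @cube_increment_bounds _ _ (sqrtr_ge0 _) st.
have -> : Num.sqrt (a + m.+1)%:R ^+ 2 - Num.sqrt (a + m)%:R ^+ 2 = 1 :> R.
  by rewrite !sqr_sqrtr // addnS -natr1; ring.
by lra.
Qed.

End sum_sqrt.

Lemma cvg_hahn_area (R : realType) :
  hahn_area R n / Num.sqrt (fib n.+1)%:R ^+ 3 @[n --> \oo]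
    --> (Num.sqrt (golden_ratio R) ^+ 3 - 1) / 3.
Proof.
pose r n : R := Num.sqrt ((fib n.+2)%:R / (fib n.+1)%:R).
have cu : (r n ^+ 3 - 1) / 3 @[n --> \oo]
    --> (Num.sqrt (golden_ratio R) ^+ 3 - 1) / 3.
  apply: cvgMl; apply: cvgB; last exact: cvg_cst.
  exact: cvg_sqrt_fib_ratio_cube.
(* The subtracted term is half of [sqrt b - sqrt a] divided by [a * sqrt a], with
   [r n = sqrt (b / a)]. *)
have cl : (r n ^+ 3 - 1) / 3 - (r n - 1) / 2 * (fib n.+1)%:R^-1 @[n --> \oo]
    --> (Num.sqrt (golden_ratio R) ^+ 3 - 1) / 3.
  rewrite -[X in _ --> X]subr0; apply: cvgB => //.
  rewrite -(mulr0 ((Num.sqrt (golden_ratio R) - 1) / 2)).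
  apply: cvgM; last exact: cvg_fib_inv.
  by apply: cvgMl; apply: cvgB; [exact: cvg_sqrt_fib_ratio|exact: cvg_cst].
apply: (squeeze_cvgr _ cl cu); apply: nearW => n.
have F0 : 0 < (fib n.+1)%:R :> R by rewrite ltr0n fib_gt0.
have s0 : 0 < Num.sqrt (fib n.+1)%:R :> R by rewrite sqrtr_gt0.
have E : fib n.+2 = (fib n.+1 + fib n)%N by [].
have := sum_sqrt_bounds R (fib n.+1) (fib n); rewrite -E.
rewrite /hahn_area -mulr_suml /r sqrtrM ?ler0n // sqrtrV ?ler0n //.
have -> : ((fib n.+1)%:R : R)^-1 = (Num.sqrt (fib n.+1)%:R ^+ 2)^-1 by rewrite sqr_sqrtr ?ler0n.
move: (\sum_(0 <= i < _) _) => S.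
move: (Num.sqrt (fib n.+2)%:R) (Num.sqrt (fib n.+1)%:R) s0 => t s s0 /andP[h1 h2].
apply/andP; split.
- have -> : ((t / s) ^+ 3 - 1) / 3 - (t / s - 1) / 2 / s ^+ 2
    = ((t ^+ 3 - s ^+ 3) / 3 - (t - s) / 2) / s ^+ 3 by field; rewrite gt_eqF.
  by rewrite ler_pM2r ?invr_gt0 ?exprn_gt0 //; lra.
- have -> : ((t / s) ^+ 3 - 1) / 3 = (t ^+ 3 - s ^+ 3) / 3 / s ^+ 3.
    by field; rewrite gt_eqF.
  by rewrite ler_pM2r ?invr_gt0 ?exprn_gt0 //; lra.
Qed.

Theorem theorem4p1 (R : realType) :
  hahn_area R n / hahn_area R n.-1 @[n --> \oo]
    --> golden_ratio R * Num.sqrt (golden_ratio R).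
Proof.
rewrite -(cvg_shiftS (fun n => hahn_area R n / hahn_area R n.-1)) /=.
have /andP[p1 _] := golden_ratio_bounds R.
set p := golden_ratio R in p1 *.
have sp1 : 1 < Num.sqrt p by rewrite -[X in X < _]sqrtr1 ltr_sqrt // (lt_trans _ p1).
have c0 : (Num.sqrt p ^+ 3 - 1) / 3 != 0.
  by rewrite gt_eqF // divr_gt0 // subr_gt0 exprn_egt1.
(* The identity [uE] also covers [n = 0]: there [hahn_area R 0] is 0, its inverse is 0 by
   convention, and both sides vanish. *)
pose u n := hahn_area R n / Num.sqrt (fib n.+1)%:R ^+ 3.
have uE n : hahn_area R n.+1 / hahn_area R n
    = u n.+1 / u n * Num.sqrt ((fib n.+2)%:R / (fib n.+1)%:R) ^+ 3.
  rewrite /u sqrtrM ?ler0n // sqrtrV ?ler0n // invf_div.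
  have s0 m : Num.sqrt (fib m.+1)%:R != 0 :> R.
    by rewrite gt_eqF // sqrtr_gt0 ltr0n fib_gt0.
  move: (s0 n) (s0 n.+1).
  move: (Num.sqrt (fib n.+1)%:R) (Num.sqrt (fib n.+2)%:R) => s t hs ht.
  (* Keeping the quotients of cubes explicit lets [ring] rearrange the product with inverses as
     atoms; only then are they cancelled, by [hs] and [ht]. *)
  rewrite [RHS](_ : _ = hahn_area R n.+1 / hahn_area R n
    * (t ^+ 3 / t ^+ 3) * (s ^+ 3 / s ^+ 3)); last by rewrite expr_div_n; ring.
  by rewrite !divff ?expf_neq0 // !mulr1.
have cu : u n @[n --> \oo] --> (Num.sqrt p ^+ 3 - 1) / 3 := @cvg_hahn_area R.
have cuS : u n.+1 @[n --> \oo] --> (Num.sqrt p ^+ 3 - 1) / 3.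
  by rewrite (cvg_shiftS u).
have -> : p * Num.sqrt p
    = (Num.sqrt p ^+ 3 - 1) / 3 / ((Num.sqrt p ^+ 3 - 1) / 3) * Num.sqrt p ^+ 3.
  by rewrite divff // mul1r exprSr sqr_sqrtr // ltW // (lt_trans _ p1).
apply: cvg_trans (cvgM (cvgM cuS (cvgV c0 cu)) (@cvg_sqrt_fib_ratio_cube R)).
by apply: near_eq_cvg; apply: nearW => n; exact: esym (uE n).
Qed.
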